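(* Let $\alpha>1$ be a constant, $c\in(0,1)$ a constant, and $n,B,B_h\in\mathbb{N}$ with $n\ge B$ and $cB\le B_h\le(1-c)B$. Items $i\in[n]$ have frequencies $f_i=1/i^\alpha$. Let $\delta\in[0,1]$ and let $\mathbf{HH}_\delta:[n]\to\{0,1\}$ be a (possibly random) heavy-hitter oracle with $\Pr[\mathbf{HH}_\delta(i)\ne[i\le B_h]]\le\delta$ for each $i\in[n]$. Consider learned Count-Min with a single hash function: every item with $\mathbf{HH}_\delta(i)=1$ is stored in its own bucket and reported exactly; every item with $\mathbf{HH}_\delta(i)=0$ is fed into a Count-Min sketch with a hash function $h:[n]\to[B-B_h]$ (truly random, independent of the oracle), with estimate $\tilde f_i=\sum_{j:\,\mathbf{HH}_\delta(j)=0}[h(j)=h(i)]f_j$. Then $$\mathbb{E}\Big[\frac1N\sum_{i\in[n]}f_i\,|\tilde f_i-f_i|\Big]=O\!\left(\frac1B\left(\delta+B^{1-\alpha}\right)^2\right),$$ where $N=\sum_{i\in[n]}f_i$ and the implied constant depends only on $\alpha$ and $c$.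
   Context: $[E]$ denotes the indicator of event $E$; $[i\le B_h]$ is the perfect classification of the $B_h$ most frequent items as heavy.
   Formalization: The formal theorem also assumes that the oracle's answers on distinct items are pairwise independent (and B ≥ 1); with only the marginal error bounds the claim fails, e.g. for an oracle that is wrong on all items at once with probability δ = B^(1−α). *)

(* Defs.v *)
From HB Require Export structures.
From mathcomp Require Export all_boot all_order all_algebra.
From mathcomp Require Export all_classical all_reals all_analysis.

Set Implicit Arguments.
Unset Strict Implicit.
Unset Printing Implicit Defensive.

Import Order.TTheory GRing.Theory Num.Theory.

Local Open Scope classical_set_scope.
Local Open Scope ring_scope.

Section FiniteRandomElements.
Context {d : measure_display} {T : measurableType d} {R : realType}.
Variable P : probability T R.

(* Measurability with respect to the discrete sigma-algebra on F. *)
Definition fin_random (F : finType) (X : T -> F) : Prop :=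
  forall x : F, measurable (X @^-1` [set x]).

Definition fin_uniform (F : finType) (X : T -> F) : Prop :=
  forall x : F, P (X @^-1` [set x]) = ((#|F|%:R : R)^-1)%:E.

Definition fin_independent (F G : finType) (X : T -> F) (Y : T -> G) : Prop :=
  forall (x : F) (y : G),
    P (X @^-1` [set x] `&` Y @^-1` [set y]) =
    (P (X @^-1` [set x]) * P (Y @^-1` [set y]))%E.

(* For the oracle, bounding the marginal error probabilities by delta does not
   suffice for a bound quadratic in delta: an oracle that with probability delta
   is wrong on all items at once has error of order delta / B. *)
Definition pairwise_independent (n : nat) (F : finType)
    (X : T -> {ffun 'I_n -> F}) : Prop :=
  forall i j : 'I_n, i != j ->
    fin_independent (fun t => X t i) (fun t => X t j).

End FiniteRandomElements.

Section LearnedCountMin.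
Context {R : realType}.

(* The ordinal i : 'I_n stands for item i.+1 of {1, ..., n}. *)
Definition zipf_freq (alpha : R) (n : nat) (i : 'I_n) : R :=
  1 / (i.+1%:R `^ alpha).

Definition is_heavy (n Bh : nat) (i : 'I_n) : bool := (i.+1 <= Bh)%N.

(* true codes the oracle answer 1 (heavy). *)
Definition learned_cm_estimate (n m : nat) (f : 'I_n -> R)
    (HH : {ffun 'I_n -> bool}) (h : {ffun 'I_n -> 'I_m}) (i : 'I_n) : R :=
  if HH i then f i else \sum_(j < n | ~~ HH j) (h j == h i)%:R * f j.

Definition weighted_error (n : nat) (f est : 'I_n -> R) : R :=
  1 / (\sum_(i < n) f i) * \sum_(i < n) f i * `|est i - f i|.

End LearnedCountMin.

(* Main.v *)
(** An item contributes an error only when it and a distinct item are both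
    labelled light and collide, so by independence the expected error is at most
    [(\sum_i f_i p_i)^2 / (B - Bh)], where [p_i] is the probability that [i] is
    labelled light and [N >= 1] is dropped.  Since [p_i <= delta] for heavy items,
    the sum is at most [delta \sum_i f_i + \sum_(i > Bh) f_i], and both sums are
    controlled by the telescoping bound
    [(alpha - 1) x^(-alpha) <= (x - 1)^(1 - alpha) - x^(1 - alpha)]. *)
Require Import Defs.
From mathcomp Require Import ring lra measurable_realfun.
Set Implicit Arguments.
Unset Strict Implicit.
Unset Printing Implicit Defensive.
Import Order.TTheory GRing.Theory Num.Theory.
Local Open Scope classical_set_scope.
Local Open Scope ring_scope.

(** * Sums of Zipf frequencies *)

Section ZipfSums.
Context {R : realType}.
Implicit Types (alpha x : R).

(** Dividing by [x ^ (1 - alpha)] leaves [1 + (alpha - 1) / x <= (1 - 1 / x) ^ (1 - alpha)]. This is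
    [1 + y <= expR y] at the exponent of the right-hand side, combined with
    [ln (1 - 1 / x) <= - 1 / x]. *)
Lemma powR_telescope_ge alpha x : 1 < alpha -> 1 < x ->
  (alpha - 1) / x `^ alpha <= (x - 1) `^ (1 - alpha) - x `^ (1 - alpha).
Proof.
move=> a1 x1.
have x0 : 0 < x by lra.
have xN0 : x != 0 by rewrite gt_eqF.
have xV0 : 0 < x^-1 by rewrite invr_gt0.
have xV1 : x^-1 < 1 by rewrite invf_lt1.
have -> : x - 1 = x * (1 - x^-1) by field.
rewrite powRM; [|lra|lra].
have -> : (alpha - 1) / x `^ alpha = x `^ (1 - alpha) * ((alpha - 1) / x).
  by rewrite powRB ?xN0 ?implybT// powRr1 ?ltW//; field; rewrite xN0 gt_eqF ?powR_gt0.
rewrite -{3}[x `^ (1 - alpha)]mulr1 -mulrBr ler_wpM2l ?powR_ge0//.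
rewrite lerBrDl /powR gt_eqF; last lra.
apply: le_trans (expR_ge1Dx _); rewrite lerD2l.
have := @le_ln1Dx R (- x^-1); rewrite ltrN2 => /(_ xV1) H.
nra.
Qed.

Lemma zipf_tail_le alpha (k n : nat) : 1 < alpha -> (0 < k)%N ->
  \sum_(k <= i < n) 1 / i.+1%:R `^ alpha <= k%:R `^ (1 - alpha) / (alpha - 1).
Proof.
move=> a1 k0; have a0 : 0 < alpha - 1 by lra.
have [nk|kn] := leqP n k.
  by rewrite big_geq// divr_ge0 ?powR_ge0// ltW.
rewrite ler_pdivlMr// mulr_suml.
apply: (@le_trans _ _ (k%:R `^ (1 - alpha) - n%:R `^ (1 - alpha))); last first.
  by rewrite gerBl powR_ge0.
have /= tel := telescope_sumr (fun i : nat => (i%:R : R) `^ (1 - alpha)) (ltnW kn).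
rewrite -[leRHS]opprB -tel.
rewrite -sumrN; apply: ler_sum_nat => i /andP[ki _].
(* The index [i] stands for item [i.+1], so the telescoping starts exactly at [k]; [0 < k] provides
   [1 < i.+1]. *)
have := @powR_telescope_ge alpha i.+1%:R a1.
rewrite ltr1n ltnS => /(_ (leq_trans k0 ki)).
by rewrite -{2}[i.+1]addn1 natrD addrK opprB div1r [_^-1 * _]mulrC.
Qed.

Lemma zipf_sum_ge1 alpha n : (0 < n)%N ->
  1 <= \sum_(i < n) zipf_freq alpha i.
Proof.
case: n => // n _; rewrite big_ord_recl /zipf_freq /= powR1 divr1 lerDl.
by apply: sumr_ge0 => i _; rewrite divr_ge0 ?powR_ge0.
Qed.

Lemma zipf_sum_le alpha n : 1 < alpha ->
  \sum_(i < n) zipf_freq alpha i <= alpha / (alpha - 1).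
Proof.
move=> a1; have a0 : 0 < alpha - 1 by lra.
case: n => [|n]; first by rewrite big_ord0 divr_ge0; lra.
rewrite /zipf_freq.
rewrite -(big_mkord xpredT (fun i : nat => 1 / (i.+1%:R : R) `^ alpha)).
(* Item 1 is split off because the telescoping bound requires [1 < x]; the remaining tail is at most
   [1 / (alpha - 1)]. *)
rewrite big_ltn// powR1 divr1.
have := @zipf_tail_le alpha 1 n.+1 a1 isT; rewrite powR1 => H.
have -> : alpha / (alpha - 1) = 1 + 1 / (alpha - 1) by field; rewrite gt_eqF.
by rewrite lerD2l.
Qed.

Lemma zipf_misclassified_sum_le alpha (n Bh : nat) (delta : R)
    (p : 'I_n -> R) : 1 < alpha -> (0 < Bh)%N -> 0 <= delta ->
  (forall i, 0 <= p i <= 1) -> (forall i, is_heavy Bh i -> p i <= delta) ->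
  \sum_(i < n) zipf_freq alpha i * p i <=
    (delta * alpha + Bh%:R `^ (1 - alpha)) / (alpha - 1).
Proof.
move=> a1 Bh0 d0 p01 pd.
have f0 (i : 'I_n) : 0 <= zipf_freq alpha i by rewrite divr_ge0 ?powR_ge0.
apply: (@le_trans _ _ (delta * \sum_(i < n) zipf_freq alpha i +
    \sum_(i < n | (Bh <= i)%N) zipf_freq alpha i)).
  rewrite mulr_sumr [X in _ <= _ + X]big_mkcond -big_split/=.
  apply: ler_sum => i _; have /andP[p0 p1] := p01 i.
  have := f0 i; case: leqP => [_|iB] fi.
    by have := mulr_ge0 d0 fi; have := ler_wpM2l fi p1; lra.
  by have := ler_wpM2l fi (pd i iB); lra.
rewrite mulrDl lerD// -?mulrA ?ler_wpM2l ?zipf_sum_le//.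
rewrite /zipf_freq.
rewrite -(big_mkord (fun i => Bh <= i)%N (fun i : nat => 1 / (i.+1%:R : R) `^ alpha)).
apply: le_trans (zipf_tail_le n a1 Bh0).
by rewrite (big_nat_widenl Bh 0 n xpredT).
Qed.

End ZipfSums.

(** * Random elements with finitely many values, and collisions of a uniform hash function *)

Section FiniteRandom.
Context {d : measure_display} {T : measurableType d} {R : realType}.
Variable P : probability T R.

Lemma fin_random_preimage (F : finType) (X : T -> F) (A : set F) :
  fin_random X -> measurable (X @^-1` A).
Proof.
move=> mX.
have -> : X @^-1` A = \bigcup_(x in A) (X @^-1` [set x]).
  apply/seteqP; split=> [t At|t [x Ax /= ->]] //.
  by exists (X t).
by apply: fin_bigcup_measurable => //; exact: finite_finset.
Qed.

(** The extra event [E] allows two random elements to be decomposed into fibres one after the other,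
    which is how independence passes from points to predicates below. *)
Lemma probability_fin_preimageI (F : finType) (X : T -> F) (p : pred F)
    (E : set T) : fin_random X -> measurable E ->
  P (X @^-1` [set x | p x] `&` E) =
  (\sum_(x | p x) P (X @^-1` [set x] `&` E))%E.
Proof.
move=> mX mE.
have -> : X @^-1` [set x | p x] `&` E =
    \bigcup_(x in [set` p]) (X @^-1` [set x] `&` E).
  apply/seteqP; split=> [t [pt Et]|t [x px [/= -> Et]]] //.
  by exists (X t).
rewrite measure_fin_bigcup; last 3 first.
- exact: finite_finset.
- by move=> x y _ _ [t [[/= -> _] [/= -> _]]].
- by move=> x _; apply: measurableI.
rewrite -(bigfs _ (r := index_enum F))//; first exact: index_enum_uniq.
by move=> x _; rewrite mem_index_enum.
Qed.

Lemma probability_fin_preimage (F : finType) (X : T -> F) (p : pred F) :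
  fin_random X ->
  P (X @^-1` [set x | p x]) = (\sum_(x | p x) P (X @^-1` [set x]))%E.
Proof.
move=> mX; rewrite -[X in P X]setIT probability_fin_preimageI//.
by apply: eq_bigr => x _; rewrite setIT.
Qed.

Lemma fin_independent_preimage (F G : finType) (X : T -> F) (Y : T -> G)
    (p : pred F) (q : pred G) :
  fin_random X -> fin_random Y -> fin_independent P X Y ->
  P (X @^-1` [set x | p x] `&` Y @^-1` [set y | q y]) =
  (P (X @^-1` [set x | p x]) * P (Y @^-1` [set y | q y]))%E.
Proof.
move=> mX mY XY.
rewrite probability_fin_preimageI//; last exact: fin_random_preimage.
rewrite [X in (X * _)%E]probability_fin_preimage// ge0_sume_distrl//.
apply: eq_bigr => x _; rewrite setIC probability_fin_preimageI//.
rewrite [X in (_ * X)%E]probability_fin_preimage// ge0_sume_distrr//.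
by apply: eq_bigr => y _; rewrite setIC XY.
Qed.

Lemma expectation_sum_indic (I : finType) (Q : pred I) (w : I -> R)
    (A : I -> set T) :
  (forall i, 0 <= w i) -> (forall i, measurable (A i)) ->
  ('E_P[fun t => \sum_(i | Q i) w i * \1_(A i) t]%R =
   \sum_(i | Q i) (w i)%:E * P (A i))%E.
Proof.
move=> w0 mA; rewrite unlock.
under eq_integral do rewrite -sumEFin -big_filter.
rewrite ge0_integral_sum//; last 2 first.
- by move=> i; apply/measurable_EFinP; apply: measurable_funM => //;
    exact: measurable_indic.
- by move=> i t _; rewrite lee_fin mulr_ge0.
rewrite big_filter; apply: eq_bigr => i _.
under eq_integral do rewrite EFinM.
rewrite ge0_integralZl_EFin//; last first.
  by apply/measurable_EFinP; exact: measurable_indic.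
by rewrite integral_indic// setIT.
Qed.

(* A function [g] with [g i = g j], together with a new value at [i], determines
   an arbitrary function, and is recovered from it by copying the value at [j]. *)
Lemma card_collision_le (n m : nat) (i j : 'I_n) : i != j ->
  (#|[pred g : {ffun 'I_n -> 'I_m} | g j == g i]| * m <=
   #|{: {ffun 'I_n -> 'I_m}}|)%N.
Proof.
move=> ij; rewrite -[m in (_ * m)%N]card_ord.
rewrite -(cardX [pred g : {ffun 'I_n -> 'I_m} | g j == g i] 'I_m).
pose upd (gk : {ffun 'I_n -> 'I_m} * 'I_m) :=
  [ffun l => if l == i then gk.2 else gk.1 l].
have upd_inj : {in predX [pred g : {ffun 'I_n -> 'I_m} | g j == g i] 'I_m &,
    injective upd}.
  move=> [g k] [g' k'] /andP[/= /eqP gji _] /andP[/= /eqP gji' _] /ffunP E.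
  have Ei := E i; rewrite !ffunE eqxx /= in Ei.
  have gE l : l != i -> g l = g' l.
    by move=> /negbTE li; have := E l; rewrite !ffunE li.
  congr pair => //; apply/ffunP => l.
  have [->|/gE//] := eqVneq l i.
  by rewrite -gji -gji' gE// eq_sym.
by rewrite -(card_in_imset upd_inj) max_card.
Qed.

Lemma fin_uniform_collision_le (n m : nat) (h : T -> {ffun 'I_n -> 'I_m})
    (i j : 'I_n) : i != j -> (0 < m)%N -> fin_random h -> fin_uniform P h ->
  (P (h @^-1` [set g | g j == g i]) <= (m%:R^-1)%:E)%E.
Proof.
move=> ij m0 mh uh; rewrite probability_fin_preimage//.
rewrite (eq_bigr (fun=> ((#|{: {ffun 'I_n -> 'I_m}}|%:R : R)^-1)%:E))//.
rewrite sumEFin lee_fin big_const iter_addr_0 -[_ *+ _]mulr_natr.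
have F0 : (0 < #|{: {ffun 'I_n -> 'I_m}}|)%N.
  by rewrite card_ffun !card_ord expn_gt0 m0.
rewrite mulrC ler_pdivrMr ?ltr0n// ler_pdivlMl ?ltr0n//.
by rewrite mulrC -natrM ler_nat card_collision_le.
Qed.

End FiniteRandom.

(** The estimate of a light item contains its own frequency as the term [j = i], so the error is the
    nonnegative sum over the other light items in its bucket and the absolute value disappears. What
    remains is a nonnegative combination of indicators, whose expectation is computed termwise. *)
Lemma weighted_error_learned_cm (R : realType) (n m : nat) (f : 'I_n -> R)
    (HH : {ffun 'I_n -> bool}) (h : {ffun 'I_n -> 'I_m}) :
  (forall i, 0 <= f i) ->
  weighted_error f (learned_cm_estimate f HH h) =
  \sum_(ij : 'I_n * 'I_n | ij.1 != ij.2)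
    f ij.1 * f ij.2 / (\sum_(i < n) f i) *
    [&& ~~ HH ij.1, ~~ HH ij.2 & h ij.2 == h ij.1]%:R.
Proof.
move=> f0; rewrite /weighted_error.
rewrite -(pair_big_dep xpredT (fun i j => i != j) (fun i j =>
  f i * f j / (\sum_(i < n) f i) * [&& ~~ HH i, ~~ HH j & h j == h i]%:R))/=.
rewrite mulr_sumr; apply: eq_bigr => i _.
rewrite /learned_cm_estimate; case: ifPn => Hi /=.
  by rewrite subrr normr0 !mulr0 big1// => j _; rewrite mulr0.
rewrite [X in `|X - _|](bigD1 i)//= eqxx [_%:R * f i]mul1r [_ - f i]addrC addKr ger0_norm; last first.
  by apply: sumr_ge0 => j _; rewrite mulr_ge0.
rewrite !mulr_sumr big_mkcondl/= [RHS](eq_bigl (fun j => j != i)); last first.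
  by move=> j; rewrite eq_sym.
apply: eq_bigr => j _; case: (HH j) => /=; first by rewrite mulr0.
by rewrite mul1r; ring.
Qed.

Theorem theoremA7 (R : realType) (alpha c : R)
    (alpha_gt1 : 1 < alpha) (c_gt0 : 0 < c) (c_lt1 : c < 1) :
  exists2 C : R, 0 < C &
    forall (n B Bh : nat) (delta : R)
      (d : measure_display) (T : measurableType d) (P : probability T R)
      (HH : T -> {ffun 'I_n -> bool}) (h : T -> {ffun 'I_n -> 'I_(B - Bh)}),
    (0 < B)%N -> (B <= n)%N ->
    c * B%:R <= Bh%:R -> Bh%:R <= (1 - c) * B%:R ->
    0 <= delta -> delta <= 1 ->
    fin_random HH ->
    (forall i : 'I_n, (P [set t | HH t i != is_heavy Bh i] <= delta%:E)%E) ->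
    pairwise_independent P HH ->
    fin_random h -> fin_uniform P h -> fin_independent P HH h ->
    ('E_P[fun t => weighted_error (zipf_freq alpha (n:=n))
                     (learned_cm_estimate (zipf_freq alpha (n:=n)) (HH t) (h t))]
     <= (C * (1 / B%:R * (delta + B%:R `^ (1 - alpha)) ^+ 2))%:E)%E.
Proof.
have a0 : 0 < alpha - 1 by lra.
pose K := (alpha + c `^ (1 - alpha)) / (alpha - 1).
have c'0 : 0 < c `^ (1 - alpha) by exact: powR_gt0.
have K0 : 0 < K by rewrite divr_gt0//; lra.
(* The factor [c^-1] pays for [c * B <= B - Bh] in the collision probability, and [c ^ (1 - alpha)]
   inside [K] pays for [c * B <= Bh] in the tail sum. *)
exists (c^-1 * K ^+ 2); first by rewrite mulr_gt0 ?invr_gt0 ?exprn_gt0.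
move=> n B Bh delta d T P HH h B0 Bn cBh Bhc d0 d1 mHH Perr piHH mh uh HHh.
have B0R : 0 < B%:R :> R by rewrite ltr0n.
have cB0 : 0 < c * B%:R by rewrite mulr_gt0.
(* This makes the truncated subtraction [B - Bh] agree with the one in [R]. *)
have BhB : (Bh <= B)%N by rewrite -(ler_nat R); nra.
have Bh0 : (0 < Bh)%N by rewrite -(ltr0n R); lra.
have cBm : c * B%:R <= (B - Bh)%:R by rewrite natrB//; lra.
have m0 : (0 < B - Bh)%N by rewrite -(ltr0n R); lra.
set f := zipf_freq alpha (n:=n).
set N := \sum_(i < n) f i.
have f0 i : 0 <= f i by rewrite divr_ge0 ?powR_ge0.
have N1 : 1 <= N by apply: zipf_sum_ge1; exact: leq_trans Bn.
pose light (i : 'I_n) := HH @^-1` [set g | ~~ g i].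
have mlight i : measurable (light i) by exact: fin_random_preimage.
pose p i := fine (P (light i)).
have pE i : P (light i) = (p i)%:E by rewrite fineK ?fin_num_measure.
have p01 i : 0 <= p i <= 1.
  by rewrite -!lee_fin -pE measure_ge0 probability_le1.
(* For a heavy item, being labelled light is exactly the oracle's error event. *)
have pd i : is_heavy Bh i -> p i <= delta.
  move=> hi; rewrite -lee_fin -pE; apply: le_trans (Perr i).
  by rewrite hi; under [X in (_ <= P X)%E]eq_set do rewrite eqb_id.
have PE i j : i != j ->
    (P (light i `&` light j `&` h @^-1` [set g | g j == g i]) <=
     (p i * p j / (B - Bh)%:R)%:E)%E.
  move=> ij.
  (* Both labels are first merged into one event of [HH], so that independence from [h] separates
     off the collision; pairwise independence then splits the labels. *)
  have -> : light i `&` light j = HH @^-1` [set g | ~~ g i && ~~ g j].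
    by apply/seteqP; split=> t /= => [[-> ->]|/andP[]].
  rewrite (fin_independent_preimage
    (fun g : {ffun 'I_n -> bool} => ~~ g i && ~~ g j)
    (fun g : {ffun 'I_n -> 'I_(B - Bh)} => g j == g i))//.
  have -> : P (HH @^-1` [set g | ~~ g i && ~~ g j]) = (p i * p j)%:E.
    have lE k : light k = (fun t => HH t k) @^-1` [set false].
      by apply/seteqP; split=> t; rewrite /light /=; case: (HH t k).
    rewrite EFinM -!pE !lE -piHH//; congr (P _).
    apply/seteqP; split=> t /=; first by move=> /andP[/negbTE -> /negbTE ->].
    by move=> [-> ->].
  rewrite [leRHS]EFinM lee_wpmul2l//; last exact: fin_uniform_collision_le.
  by rewrite lee_fin mulr_ge0//; [have /andP[] := p01 i|have /andP[] := p01 j].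
pose A (ij : 'I_n * 'I_n) := light ij.1 `&` light ij.2 `&`
  h @^-1` [set g | g ij.2 == g ij.1].
have -> : (fun t => weighted_error f (learned_cm_estimate f (HH t) (h t))) =
    (fun t => \sum_(ij : 'I_n * 'I_n | ij.1 != ij.2)
      f ij.1 * f ij.2 / N * \1_(A ij) t).
  apply/funext => t; rewrite weighted_error_learned_cm//.
  apply: eq_bigr => ij _; rewrite indicE; congr (_ * (nat_of_bool _)%:R).
  apply/idP/idP; rewrite inE /=; first by move=> /and3P[].
  by move=> [[-> ->] ->].
rewrite expectation_sum_indic; last 2 first.
- by move=> ij; rewrite divr_ge0 ?mulr_ge0//; lra.
- by move=> ij; rewrite /A; do 2?apply: measurableI => //; exact: fin_random_preimage.
pose S := \sum_(i < n) f i * p i.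
have S_le : S <= K * (delta + B%:R `^ (1 - alpha)).
  apply: le_trans (zipf_misclassified_sum_le alpha_gt1 Bh0 d0 p01 pd) _.
  rewrite /K mulrAC ler_wpM2r ?invr_ge0 ?(ltW a0)//.
  (* The exponent is negative, so the lower bound on [Bh] becomes an upper bound on the power. *)
  have BhcB : Bh%:R `^ (1 - alpha) <= c `^ (1 - alpha) * B%:R `^ (1 - alpha).
    rewrite -powRM ?(ltW c_gt0)// -opprB !powRN lef_pV2 ?posrE ?powR_gt0// ?ltr0n//.
    by rewrite ge0_ler_powR ?nnegrE ?(ltW a0) ?(ltW cB0).
  have := powR_ge0 (B%:R : R) (1 - alpha); nra.
have S0 : 0 <= S.
  by apply: sumr_ge0 => i _; rewrite mulr_ge0//; have /andP[] := p01 i.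
apply: (@le_trans _ _ ((S ^+ 2 / (B - Bh)%:R)%:E)).
  (* The square expands over all pairs; the diagonal ones, absent from the error, only add
     nonnegative terms. *)
  rewrite expr2 /S big_distrlr/= pair_big/= mulr_suml -sumEFin big_mkcond/=.
  apply: lee_sum => -[i j] _ /=.
  have /andP[pi0 _] := p01 i; have /andP[pj0 _] := p01 j.
  case: ifPn => [ij|_]; last by rewrite lee_fin !mulr_ge0 ?invr_ge0.
  apply: (@le_trans _ _ ((f i * f j)%:E * (p i * p j / (B - Bh)%:R)%:E)%E).
    apply: lee_pmul => //; last exact: PE.
      by rewrite lee_fin divr_ge0 ?mulr_ge0//; lra.
    by rewrite lee_fin ler_pdivrMr ?ler_peMr ?mulr_ge0//; lra.
  rewrite -EFinM lee_fin [leLHS]mulrA ler_wpM2r ?invr_ge0//.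
  by rewrite mulrACA.
rewrite lee_fin.
have -> : c^-1 * K ^+ 2 * (1 / B%:R * (delta + B%:R `^ (1 - alpha)) ^+ 2) =
    (K * (delta + B%:R `^ (1 - alpha))) ^+ 2 / (c * B%:R).
  by field; rewrite !gt_eqF.
apply: ler_pM; rewrite ?exprn_ge0 ?invr_ge0//.
  by rewrite ler_sqr ?nnegrE// (le_trans S0).
by rewrite lef_pV2 ?posrE// ltr0n.
Qed.
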